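(* If $n$ and $m$ are sufficiently large, the bounded-error randomized query complexity of $h_{1,n,m}$ satisfies $R(h_{1,n,m})=\Omega\!\left(\frac{nm}{\log m}\right)$.
   Context: Let $n,m$ be positive integers, $M=[n]\times[m]$ (a grid of cells with $n$ rows and $m$ columns), $\tilde M=M\cup\{\bot\}$ (pointers to cells, $\bot$ the null pointer). Let $T$ be the following fixed binary tree with $m$ leaves and $m-1$ internal nodes: if $m=2^r$, $T$ is the complete binary tree with $2^r$ leaves; if $2^r<m<2^{r+1}$, take the complete binary tree with $2^r$ leaves and add a pair of children to each of its $m-2^r$ leftmost leaves. Outgoing arcs are labeled 'left'/'right', leaves labeled $1,\dots,m$ from left to right, and $T(j)$ is the sequence of labels on the root-to-leaf-$j$ path. The alphabet is $\Sigma=\{0,1\}\times\tilde M\times\tilde M\times\tilde M$ with components $\mathrm{val},\mathrm{lpoint},\mathrm{rpoint},\mathrm{ipoint}$. The function $h_{1,n,m}\colon\Sigma^M\to\{0,1\}$ has $h_{1,n,m}(x)=1$ iff: (1) there is exactly one column $b$ with $\mathrm{val}(x_{i,b})=1$ for all $i\in[n]$ (marked column); (2) column $b$ contains a unique cell $a$ with $x_{a}\ne(1,\bot,\bot,\bot)$ (special element); (3) $\mathrm{ipoint}(x_{a})=a$; (4) for each column $j\ne b$, the path starting at $a$ and following $\mathrm{lpoint},\mathrm{rpoint}$ as specified by $T(j)$ exists (no $\bot$ on it) and ends at a cell $\ell_j$ in column $j$ with $\mathrm{val}(x_{\ell_j})=0$. A query returns the symbol $x_c\in\Sigma$ of one cell.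 $R(f)$ is the minimum worst-case expected number of queries of a randomized decision tree that outputs $f(x)$ with probability at least $9/10$ on every input $x$. *)

(* Defs.v *)
From HB Require Import structures.
From mathcomp Require Import all_boot all_order all_algebra.
From mathcomp Require Import classical_sets reals exp.
From mathcomp Require Import Rstruct.
Set Implicit Arguments. Unset Strict Implicit. Unset Printing Implicit Defensive.
Import Order.TTheory GRing.Theory Num.Theory.
Local Open Scope ring_scope.

Notation RR := Rdefinitions.R.

Inductive dtree (Q A : Type) : Type :=
  | DLeaf : bool -> dtree Q A
  | DNode : Q -> (A -> dtree Q A) -> dtree Q A.
Arguments DLeaf {Q A}.
Arguments DNode {Q A}.

Section Query.
Variables (Q A : finType).

Fixpoint dt_eval (t : dtree Q A) (x : {ffun Q -> A}) : bool :=
  match t with DLeaf b => b | DNode q k => dt_eval (k (x q)) x end.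

Fixpoint dt_queries (t : dtree Q A) (x : {ffun Q -> A}) : nat :=
  match t with DLeaf _ => 0%N | DNode q k => (dt_queries (k (x q)) x).+1 end.

(* Randomized decision tree: a finitely supported probability distribution
   over deterministic decision trees (list of (weight, tree)). *)
Definition rdtree := seq (RR * dtree Q A).

Definition rdt_valid (T : rdtree) : Prop :=
  all (fun p => 0 <= p.1) T /\ \sum_(p <- T) p.1 = 1.

Definition rdt_success (T : rdtree) (f : {ffun Q -> A} -> bool)
  (x : {ffun Q -> A}) : RR :=
  \sum_(p <- T | dt_eval p.2 x == f x) p.1.

Definition rdt_cost (T : rdtree) (x : {ffun Q -> A}) : RR :=
  \sum_(p <- T) p.1 * (dt_queries p.2 x)%:R.

(* worst-case expected number of queries (costs are >= 0 for valid T) *)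
Definition rdt_worst_cost (T : rdtree) : RR :=
  \big[Num.max/0]_(x : {ffun Q -> A}) rdt_cost T x.

Definition Rquery (f : {ffun Q -> A} -> bool) : RR :=
  inf [set w : RR | exists T : rdtree,
        [/\ rdt_valid T,
            (forall x, 9 / 10 <= rdt_success T f x) &
            w = rdt_worst_cost T]].
End Query.

Definition cell (n m : nat) := ('I_n * 'I_m)%type.
Definition Sigma (n m : nat) :=
  (bool * option (cell n m) * option (cell n m) * option (cell n m))%type.

Definition sval n m (s : Sigma n m) : bool := s.1.1.1.
Definition lpoint n m (s : Sigma n m) : option (cell n m) := s.1.1.2.
Definition rpoint n m (s : Sigma n m) : option (cell n m) := s.1.2.
Definition ipoint n m (s : Sigma n m) : option (cell n m) := s.2.

(* The tree T with m leaves.  Directions: false = left, true = right.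
   r = floor(log2 m), k = m - 2^r leftmost leaves of the complete tree of
   depth r are split.  Leaf j (0-indexed, j < m; paper's leaf j+1):
   - if j < 2k: r-bit binary expansion (MSB first) of j/2, then bit (j mod 2);
   - else:      r-bit binary expansion of j - k. *)
Definition bits (r i : nat) : seq bool :=
  [seq odd (i %/ 2 ^ (r - 1 - t)) | t <- iota 0 r].

Definition Tpath (m j : nat) : seq bool :=
  let r := trunc_log 2 m in
  let k := (m - 2 ^ r)%N in
  if (j < 2 * k)%N then rcons (bits r (j %/ 2)) (odd j)
  else bits r (j - k).

Definition follow n m (x : {ffun cell n m -> Sigma n m}) (c : cell n m)
  (p : seq bool) : option (cell n m) :=
  foldl (fun oc (d : bool) =>
           match oc with
           | Some c' => if d then rpoint (x c') else lpoint (x c')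
           | None => None
           end) (Some c) p.

Definition col_marked n m (x : {ffun cell n m -> Sigma n m}) (j : 'I_m) : bool :=
  [forall i : 'I_n, sval (x (i, j))].

Definition h1 (n m : nat) (x : {ffun cell n m -> Sigma n m}) : bool :=
  [exists b : 'I_m,
    [&& col_marked x b,
        [forall b' : 'I_m, col_marked x b' ==> (b' == b)] &
        [exists i : 'I_n,
          [&& x (i, b) != (true, None, None, None),
              [forall i' : 'I_n, (x (i', b) != (true, None, None, None))
                                    ==> (i' == i)],
              ipoint (x (i, b)) == Some (i, b) &
              [forall j : 'I_m, (j != b) ==>
                 match follow x (i, b) (Tpath m j) with
                 | Some l => (l.2 == j) && ~~ sval (x l)
                 | None => false
                 end]]]]].

(* Main.v *)
Require Import Defs.
From HB Require Import structures.
From mathcomp Require Import classical_sets reals exp Rstruct.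
From mathcomp Require Import all_boot all_order all_algebra.
From mathcomp Require Import zify lra.
Set Implicit Arguments. Unset Strict Implicit. Unset Printing Implicit Defensive.
Import Order.TTheory GRing.Theory Num.Theory.
Local Open Scope ring_scope.

(* Number the nodes of T as in a heap: the root is 1, the children of [v] are
    [2v] and [2v+1], the internal nodes are [1..m-1] and the leaves [m..2m-1].
    Hide the internal nodes at random distinct cells in the left half of the
    columns, and one 0-valued leaf at a random row of each right column.  Such a
    board is a negative input, but replacing the leaf of any right column by a
    copy of the root symbol makes it positive; hence a correct algorithm must
    query each right leaf with probability at least 8/10.

    A leaf is found only if it, or one of its O(log m) ancestors, is queried
    before its parent is, i.e. without having seen any pointer to it.  Until
    then, moving that node to a free unqueried cell of its region would not
    change the run, so the probability of this is at most O(q / |region|) where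
    q is the expected number of queries in the region.  Summing over leaves, the
    expected number of leaves found is O(log m / n) times the cost, and it must
    be at least 8/10 of m/2. *)

Lemma sum_card_dep (S T : finType) (D : {set S}) (F : S -> {set T}) :
  (\sum_(x in D) #|F x| = #|[set p | (p.1 \in D) && (p.2 \in F p.1)]|)%N.
Proof.
under eq_bigr do rewrite -sum1_card.
by rewrite pair_big_dep -sum1_card; apply: eq_bigl => p; rewrite [RHS]inE.
Qed.

(** * Runs of decision trees *)

Section Trace.
Variables (Q A : finType).
Implicit Types (t : dtree Q A) (x y : {ffun Q -> A}).

Fixpoint dt_trace t x : seq Q :=
  match t with DLeaf _ => [::] | DNode q k => q :: dt_trace (k (x q)) x end.

Lemma size_dt_trace t x : size (dt_trace t x) = dt_queries t x.
Proof. by elim: t => //= q k IH; rewrite IH. Qed.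

Lemma eq_dt_eval t x y :
  (forall q, q \in dt_trace t x -> x q = y q) -> dt_eval t x = dt_eval t y.
Proof.
elim: t => //= q k IH xy.
rewrite -(xy q) ?mem_head //; apply: IH => q' q'x.
by apply: xy; rewrite inE q'x orbT.
Qed.

(** The two runs make the same queries as long as the answers agree, hence at least until [d] is
    queried. *)
Lemma mem_dt_trace_prefix t x y d :
    (forall q, q \in take (index d (dt_trace t x)) (dt_trace t x) -> x q = y q) ->
  d \in dt_trace t x -> d \in dt_trace t y.
Proof.
elim: t => //= q k IH; rewrite [q == d]eq_sym !inE.
case: eqVneq => //= _ xy; rewrite -(xy q) ?mem_head //.
by apply: IH => q' q'x; apply: xy; rewrite inE q'x orbT.
Qed.

(** The brute-force tree: [x] accumulates the answers, so that [f] can be evaluated at the leaf. *)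
Fixpoint full_tree (f : {ffun Q -> A} -> bool) (s : seq Q) x : dtree Q A :=
  if s is q :: s' then
    DNode q (fun a => full_tree f s' [ffun q' => if q' == q then a else x q'])
  else DLeaf (f x).

Lemma full_treeP f s x y :
  (forall q, q \notin s -> x q = y q) -> dt_eval (full_tree f s x) y = f y.
Proof.
elim: s x => [|q s IH] x xy /=.
  by congr f; apply/ffunP => q; apply: xy.
apply: IH => q' q's; rewrite ffunE; case: eqVneq => [-> //|q'q].
by apply: xy; rewrite inE negb_or q'q.
Qed.

End Trace.

(** * Items hidden at random cells and found without a pointer *)

Section Hiding.
Variables (I Q A : finType) (inp : {ffun I -> Q} -> {ffun Q -> A}).
Variables (par : I -> I) (G : I -> {set Q}).
Implicit Types (z : {ffun I -> Q}) (t : dtree Q A).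

Definition placements := [set z : {ffun I -> Q} | injectiveb z & [forall u, z u \in G u]].

Definition move z u c : {ffun I -> Q} := [ffun v => if v == u then c else z v].

Definition before t z u :=
  take (index (z u) (dt_trace t (inp z))) (dt_trace t (inp z)).

(** The item is hit blindly: the cell of its parent, the only one that may point to it, has not been
    read yet. *)
Definition fresh t z u :=
  (z u \in dt_trace t (inp z)) && (z (par u) \notin before t z u).

Lemma placement_inj z : z \in placements -> injective z.
Proof. by rewrite inE => /andP[/injectiveP]. Qed.

Lemma placement_mem z u : z \in placements -> z u \in G u.
Proof. by rewrite inE => /andP[_ /forallP]. Qed.

Lemma move_placement z u c : z \in placements -> c \in G u ->
  c \notin [set z v | v in I] -> move z u c \in placements.
Proof.
move=> zP cG cz; have zI := placement_inj zP.
have cNz v : c <> z v by move=> cv; case/negP: cz; rewrite cv imset_f.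
rewrite inE; apply/andP; split.
  apply/injectiveP => v w; rewrite !ffunE.
  case: eqVneq => [->|vu]; case: eqVneq => [->|wu] //.
  - by move/cNz.
  - by move/esym/cNz.
  - exact: zI.
apply/forallP => v; rewrite ffunE; case: eqVneq => [-> //|_].
exact: placement_mem.
Qed.

Hypothesis inp_move : forall z u c q, z \in placements -> c \in G u ->
  c \notin [set z v | v in I] -> q != z u -> q != c -> q != z (par u) ->
  inp (move z u c) q = inp z q.

(** None of the three cells that the move can change is read before [z u]: the old cell by the
    choice of the prefix, [c] by assumption, the parent's cell by freshness. *)
Lemma move_trace t z u c : z \in placements -> fresh t z u -> c \in G u ->
  c \notin [set z v | v in I] -> c \notin before t z u ->
  z u \in dt_trace t (inp (move z u c)).
Proof.
move=> zP /andP[zt parN] cG cz cN.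
apply: mem_dt_trace_prefix zt => q qb; apply/esym/inp_move => //.
- apply: contraTneq qb => ->; rewrite -/(before t z u) /before.
  by rewrite in_take_leq ?ltnn ?index_size.
- by apply: contraTneq qb => ->.
- by apply: contraTneq qb => ->.
Qed.

(* Moving the item [u] to a free unqueried cell [c] does not change the run
   until [z u] is queried; conversely [(z, c)] is recovered from the moved
   placement and the queried cell [z u]. *)
Lemma fresh_bound t u :
    (forall z, z \in placements ->
       (2 * #|G u :&: [set z v | v in I]| <= #|G u|)%N) ->
  (#|[set z in placements | fresh t z u]| * #|G u| <=
   4 * \sum_(z in placements) #|[set c in G u | c \in dt_trace t (inp z)]|)%N.
Proof.
move=> occ.
set F := [set z in placements | fresh t z u].
set S := (\sum_(z in placements) _)%N.
pose av z := [set c in G u | (c \notin [set z v | v in I]) && (c \notin before t z u)].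
have S1 : (\sum_(z in F) #|av z| <= S)%N.
  pose P := [set zc : {ffun I -> Q} * Q | (zc.1 \in F) && (zc.2 \in av zc.1)].
  pose P' := [set zd : {ffun I -> Q} * Q | (zd.1 \in placements) &&
    (zd.2 \in [set c in G u | c \in dt_trace t (inp zd.1)])].
  rewrite /S !sum_card_dep -/P -/P'.
  pose f (zc : {ffun I -> Q} * Q) := (move zc.1 u zc.2, zc.1 u).
  have fI : {in P &, injective f}.
    move=> [z c] [z' c'] _ _ [] /ffunP e eu.
    have -> : c = c' by have := e u; rewrite !ffunE eqxx.
    congr (_, _); apply/ffunP => v; have := e v; rewrite !ffunE.
    by case: eqVneq => [->|].
  rewrite -(card_in_imset fI).
  apply/subset_leq_card/subsetP => _ /imsetP[[z c] zcP ->].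
  move: zcP; rewrite inE => /andP[/=]; rewrite inE => /andP[zP zf].
  rewrite inE => /and3P[cG cz cb].
  rewrite inE; apply/andP; split=> /=; first exact: move_placement.
  by rewrite inE placement_mem // move_trace.
(* Each cell of the region is available, occupied or queried, and the occupied ones fill at most
   half of it; solving for the size of the region doubles the other two terms. *)
have S2 z : z \in F -> (#|G u| <= 2 * #|av z| +
    2 * #|[set c in G u | c \in dt_trace t (inp z)]|)%N.
  rewrite inE => /andP[zP zf].
  have := occ z zP.
  have : (#|G u| <= #|av z| + #|G u :&: [set z v | v in I]| +
      #|[set c in G u | c \in dt_trace t (inp z)]|)%N.
    apply: leq_trans (_ : #|(av z :|: (G u :&: [set z v | v in I])) :|:
      [set c in G u | c \in dt_trace t (inp z)]| <= _)%N.
      apply/subset_leq_card/subsetP => c cG.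
      rewrite in_setU in_setU in_setI !inE cG /=.
      case: (c \in imset _ _) => //=; case cb: (c \in before t z u) => //=.
      exact: mem_take cb.
    by apply: leq_trans (leq_card_setU _ _) _; rewrite leq_add2r leq_card_setU.
  lia.
have S3 : (\sum_(z in F) #|[set c in G u | c \in dt_trace t (inp z)]| <= S)%N.
  rewrite /S [X in (_ <= X)%N](big_setID F) /=.
  have -> : placements :&: F = F by apply/setIidPr/subsetP => z; rewrite inE => /andP[].
  exact: leq_addr.
have : (\sum_(z in F) #|G u| <= \sum_(z in F) (2 * #|av z| +
    2 * #|[set c in G u | c \in dt_trace t (inp z)]|))%N by apply: leq_sum.
rewrite sum_nat_const big_split /= -!big_distrr /=.
move=> /leq_trans; apply.
rewrite -mulnDr (_ : 4 = 2 * 2)%N // -mulnA leq_mul2l /=.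
by rewrite mul2n -addnn leq_add.
Qed.

(* An item that is its own parent is fresh as soon as it is queried. *)
Lemma exists_fresh t z u K : (iter K par u = par (iter K par u)) ->
  z u \in dt_trace t (inp z) ->
  exists k : 'I_K.+1, fresh t z (iter k par u).
Proof.
elim: K u => [|K IH] u.
  move=> /= e zt; exists ord0 => /=; rewrite /fresh zt -e /before.
  by rewrite in_take_leq ?ltnn ?index_size.
rewrite iterSr => /IH{}IH zt.
case zf: (fresh t z u); first by exists ord0.
move: zf; rewrite /fresh zt /= => /negbFE /mem_take /IH[k kf].
by exists (lift ord0 k); rewrite lift0 iterSr.
Qed.

End Hiding.

(** * Heap numbering of the leaves of the tree *)

Section Heap.

Definition heap_index (v : nat) (s : seq bool) : nat :=
  foldl (fun k (d : bool) => 2 * k + d)%N v s.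

Lemma heap_index_ge v s : (v <= heap_index v s)%N.
Proof.
elim: s v => //= d s IH v; apply: leq_trans (IH _).
by rewrite mul2n -addnn -addnA leq_addr.
Qed.

Lemma heap_index_rcons v s (d : bool) :
  heap_index v (rcons s d) = (2 * heap_index v s + d)%N.
Proof. by rewrite /heap_index -cats1 foldl_cat. Qed.

Lemma bitsS r i : bits r.+1 i = rcons (bits r (i %/ 2)) (odd i).
Proof.
rewrite /bits -(addn1 r) iotaD map_cat cats1 add0n addn1 subn1 /= subnn divn1.
congr rcons; apply/eq_in_map => t; rewrite mem_iota add0n => /andP[_ tr].
by rewrite -divnMA -expnS; congr (odd (_ %/ 2 ^ _)); lia.
Qed.

Lemma heap_index_bits r v i : (i < 2 ^ r)%N ->
  heap_index v (bits r i) = (v * 2 ^ r + i)%N.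
Proof.
elim: r i => [|r IH] i; first by case: i => // _; rewrite muln1 addn0.
rewrite expnS => ir; rewrite bitsS heap_index_rcons.
by rewrite IH; have := divn_eq i 2; rewrite modn2; lia.
Qed.

(** With [r = trunc_log 2 m] and [k = m - 2 ^ r], the [2 * k] leftmost leaves have depth [r + 1] and
    are numbered from [2 ^ r.+1] on; the others have depth [r] and number [2 ^ r + (j - k)]. *)
Lemma heap_index_Tpath m j : (j < m)%N ->
  heap_index 1 (Tpath m j) =
  if (j < 2 * (m - 2 ^ trunc_log 2 m))%N then (2 ^ (trunc_log 2 m).+1 + j)%N
  else (2 * 2 ^ trunc_log 2 m + j - m)%N.
Proof.
move=> jm; have /andP[] := @trunc_log_bounds 2 m isT (leq_ltn_trans (leq0n j) jm).
rewrite /Tpath expnS; set r := trunc_log 2 m; set P := (2 ^ r)%N => Pm mP.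
case: ifP => jk.
  rewrite heap_index_rcons heap_index_bits -/P.
    by have := divn_eq j 2; rewrite modn2; lia.
  by lia.
by rewrite heap_index_bits -/P; lia.
Qed.

(** Inverse of the leaf numbering: numbers from [2 ^ r.+1] on form the deepest level, which serves
    the leftmost columns. *)
Definition leaf_column m u : nat :=
  if (2 ^ (trunc_log 2 m).+1 <= u)%N then (u - 2 ^ (trunc_log 2 m).+1)%N
  else (u + m - 2 ^ (trunc_log 2 m).+1)%N.

Lemma leaf_columnP m u : (m <= u < 2 * m)%N ->
  (leaf_column m u < m)%N /\ heap_index 1 (Tpath m (leaf_column m u)) = u.
Proof.
move=> /andP[mu um]; have m0 : (0 < m)%N by lia.
have /andP[] := @trunc_log_bounds 2 m isT m0.
have cm : (leaf_column m u < m)%N.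
  have /andP[] := @trunc_log_bounds 2 m isT m0.
  by rewrite /leaf_column expnS; case: ifP; lia.
split=> //; rewrite heap_index_Tpath //.
move: cm; rewrite /leaf_column expnS; case: ifP => ? ?; case: ifP; lia.
Qed.

Lemma heap_index_Tpath_bounds m j : (j < m)%N ->
  (m <= heap_index 1 (Tpath m j) < 2 * m)%N.
Proof.
move=> jm; have /andP[] := @trunc_log_bounds 2 m isT (leq_ltn_trans (leq0n j) jm).
by rewrite heap_index_Tpath // expnS; case: ifP; lia.
Qed.

Lemma heap_index_Tpath_inj m j j' : (j < m)%N -> (j' < m)%N ->
  heap_index 1 (Tpath m j) = heap_index 1 (Tpath m j') -> j = j'.
Proof.
move=> jm jm'.
have /andP[] := @trunc_log_bounds 2 m isT (leq_ltn_trans (leq0n j) jm).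
by rewrite !heap_index_Tpath // expnS; case: ifP; case: ifP; lia.
Qed.

End Heap.

(** * Boards that encode the tree, without and with a root *)

Section Board.
Variables n m : nat.
Hypotheses (n_gt15 : (15 < n)%N) (m_gt3 : (3 < m)%N).
Local Notation node := 'I_(2 * m).
Local Notation input := {ffun cell n m -> Sigma n m}.
Implicit Types (z : {ffun node -> cell n m}) (u v : node) (j : 'I_m).

Lemma leaf_proof j : (heap_index 1 (Tpath m j) < 2 * m)%N.
Proof. by have /andP[] := heap_index_Tpath_bounds (ltn_ord j). Qed.

Definition leaf j : node := Ordinal (leaf_proof j).

Lemma leaf_ge j : (m <= leaf j)%N.
Proof. by have /andP[] := heap_index_Tpath_bounds (ltn_ord j). Qed.

Lemma leaf_inj : injective leaf.
Proof.
move=> j j' /(congr1 val) /= /heap_index_Tpath_inj e; apply: val_inj.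
exact: e.
Qed.

Lemma parent_proof u : (u./2 < 2 * m)%N.
Proof. by apply: leq_ltn_trans (ltn_ord u); rewrite leq_half_double; lia. Qed.

(* Node 0 is a dummy internal node, its own parent and the parent of node 1, so
   that every chain of parents stabilizes there; node 1 is placed as well, but
   nothing except node 0 points to it. *)
Definition parent u : node := Ordinal (parent_proof u).

(* Internal nodes live in the left half of the columns, away from row 0; the
   leaf of such a column is pinned to row 0. *)
Definition region u : {set cell n m} :=
  if (u < m)%N then [set c : cell n m | (0 < c.1)%N && (c.2 < uphalf m)%N]
  else [set c : cell n m | (leaf c.2 == u) &&
                           ((c.2 < uphalf m)%N ==> (c.1 == 0 :> nat))].

Local Notation placed := (placements region).

(** Internal nodes carry the value 1, so its leaf alone keeps a column from being marked. *)
Definition symbol_at z u : Sigma n m :=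
  if (u < m)%N then
    (true, omap z (insub (2 * u)%N), omap z (insub (2 * u).+1), None)
  else (false, None, None, None).

Definition board z : input :=
  [ffun c => if [pick u | z u == c] is Some u then symbol_at z u
             else (true, None, None, None)].

(** The cell of [leaf j] takes over the pointers of node 1, whose children are 2 and 3, and points
    to itself as a special element must. *)
Definition rooted_board z j : input :=
  [ffun c => if c == z (leaf j) then
      (true, omap z (insub 2), omap z (insub 3), Some (z (leaf j)))
    else board z c].

Lemma boardE z u : injective z -> board z (z u) = symbol_at z u.
Proof.
move=> zI; rewrite ffunE; case: pickP => [v /eqP/zI -> //|/(_ u)].
by rewrite eqxx.
Qed.

Lemma board_out z c : c \notin [set z v | v in node] ->
  board z c = (true, None, None, None).
Proof.
move=> cz; rewrite ffunE; case: pickP => // v /eqP zv.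
by case/negP: cz; rewrite -zv imset_f.
Qed.

(** The symbol of a node depends only on the cells of its children, so besides the two ends of the
    move only the parent's cell can change. *)
Lemma board_move z u c q : z \in placed -> c \in region u ->
  c \notin [set z v | v in node] -> q != z u -> q != c -> q != z (parent u) ->
  board (move z u c) q = board z q.
Proof.
move=> zP cr cz qu qc qp; have zI := placement_inj zP.
have zI' := placement_inj (move_placement zP cr cz).
case: (boolP (q \in [set z v | v in node])) => [/imsetP[v _ qv]|qz].
  have vu : v != u by apply: contraNneq qu => <-; rewrite qv.
  have qv' : q = move z u c v by rewrite ffunE (negPf vu).
  rewrite {1}qv' qv !boardE // /symbol_at.
  case: ifP => // vm.
  have vp : v != parent u by apply: contraNneq qp => <-; rewrite qv.
  have e i : i./2 = v -> omap (move z u c) (insub i) = omap z (insub i).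
    move=> iv; case: insubP => //= w _ wi; rewrite ffunE; case: eqVneq => // wu.
    by case/eqP: vp; apply: val_inj => /=; rewrite -wu wi iv.
  by rewrite !e //; lia.
rewrite !board_out //; apply/imsetP => -[v _]; rewrite ffunE.
case: eqVneq => _ qv; first by rewrite qv eqxx in qc.
by case/imsetP: qz; exists v.
Qed.

Lemma placed_leaf_column z j : z \in placed -> (z (leaf j)).2 = j.
Proof.
move=> /(placement_mem (leaf j)); rewrite /region ltnNge leaf_ge /= inE.
by move=> /andP[/eqP/leaf_inj].
Qed.

Lemma placed_right_column z u j : z \in placed -> (uphalf m <= j)%N ->
  (z u).2 = j -> u = leaf j.
Proof.
move=> /(placement_mem u); rewrite /region; case: ifP => _; rewrite inE.
  by move=> /andP[_ +] + e; rewrite e; lia.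
by move=> /andP[/eqP lu _] _ <-; rewrite lu.
Qed.

Lemma board_leaf_val z j : z \in placed -> Defs.sval (board z (z (leaf j))) = false.
Proof.
move=> zP; rewrite boardE; last exact: placement_inj zP.
by rewrite /symbol_at ltnNge leaf_ge.
Qed.

(** Every column contains its 0-valued leaf, so no column is marked. *)
Lemma h1_board z : z \in placed -> h1 (board z) = false.
Proof.
move=> zP; apply/existsP => -[j /and3P[/forallP/(_ (z (leaf j)).1)]].
by rewrite -{2}(placed_leaf_column j zP) -surjective_pairing board_leaf_val.
Qed.

Lemma rooted_board_neq z j c : c != z (leaf j) -> rooted_board z j c = board z c.
Proof. by rewrite ffunE => /negPf ->. Qed.

(** All nodes met before the end of the path are internal, so the walk never reads the cell of
    [leaf j], the only one where the two boards differ. *)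
Lemma follow_rooted z j (v : nat) s : z \in placed -> (heap_index v s < 2 * m)%N ->
  foldl (fun oc (d : bool) =>
           match oc with
           | Some c' => if d then rpoint (rooted_board z j c')
                        else lpoint (rooted_board z j c')
           | None => None
           end) (omap z (insub v)) s =
  omap z (insub (heap_index v s)).
Proof.
move=> zP; have zI := placement_inj zP.
elim: s v => //= d s IH v sm; rewrite -IH //; congr foldl.
have := leq_ltn_trans (heap_index_ge _ _) sm => vm.
have v2m : (v < 2 * m)%N by lia.
rewrite (insubT (fun i => i < 2 * m)%N v2m) /= rooted_board_neq.
  rewrite boardE // /symbol_at /= (_ : (v < m)%N); last by lia.
  by case: d {sm IH vm}; rewrite /rpoint /lpoint /= ?addn1 ?addn0.
apply/eqP => /zI /(congr1 val) /= e.
by have := leaf_ge j; rewrite /= -e; lia.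
Qed.

Lemma h1_rooted_board z j : z \in placed -> (uphalf m <= j)%N ->
  h1 (rooted_board z j).
Proof.
move=> zP jD; have zI := placement_inj zP.
have leafN j' : j' != j -> z (leaf j') != z (leaf j).
  by apply: contra_neq => /zI/leaf_inj.
have zj : z (leaf j) = ((z (leaf j)).1, j).
  by rewrite [LHS]surjective_pairing placed_leaf_column.
have rootE : rooted_board z j (z (leaf j)) =
    (true, omap z (insub 2), omap z (insub 3), Some (z (leaf j))).
  by rewrite ffunE eqxx.
have defj i : (i, j) != z (leaf j) ->
    rooted_board z j (i, j) = (true, None, None, None).
  move=> ij; rewrite rooted_board_neq // board_out //.
  apply/imsetP => -[u _ iu]; case/eqP: ij; rewrite iu; congr (z _).
  by apply: (placed_right_column zP) => //; rewrite -iu.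
rewrite /h1; apply/existsP; exists j; apply/and3P; split.
- apply/forallP => i; case: (eqVneq (i, j) (z (leaf j))) => [->|/defj->//].
  by rewrite rootE.
- apply/forallP => j'; apply/implyP => /forallP/(_ (z (leaf j')).1).
  rewrite -{2}(placed_leaf_column j' zP) -surjective_pairing.
  apply: contraTT => j'j.
  by rewrite rooted_board_neq ?leafN // board_leaf_val.
apply/existsP; exists (z (leaf j)).1; rewrite -zj; apply/and4P; split.
- by rewrite rootE; apply/eqP => -[].
- apply/forallP => i; apply/implyP.
  case: (eqVneq (i, j) (z (leaf j))) => [<- //|/defj->]; by rewrite eqxx.
- by rewrite rootE /ipoint /= eqxx.
apply/forallP => j'; apply/implyP => j'j.
have := leaf_proof j'; have := leaf_ge j'; rewrite /= /follow.
(* The path is not empty, for otherwise its leaf would be node 1, which is below [m]. *)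
case E: (Tpath m j') => [|d s] /=; first by lia.
rewrite rootE => _ sm.
(* The first step leaves the root copy for a child of node 1; from there on the walk follows placed
   nodes. *)
rewrite (_ : (if d then _ else _) = omap z (insub (2 * 1 + d)%N)); last by case: d {E sm}.
rewrite follow_rooted //.
rewrite (insubT (fun i => i < 2 * m)%N sm) /=.
have -> : Sub (heap_index (2 * 1 + d) s) sm = leaf j' :> node.
  by apply: val_inj; rewrite /= E.
rewrite placed_leaf_column // eqxx rooted_board_neq ?leafN //.
by rewrite board_leaf_val.
Qed.

(** * Sizes of the regions and existence of a placement *)

Lemma card_left : #|[set j : 'I_m | (j < uphalf m)%N]| = uphalf m.
Proof.
rewrite -sum1dep_card -(big_ord_widen m (fun=> 1%N)) ?sum1_card ?card_ord //.
by rewrite leq_uphalf_double -addnn leq_addr.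
Qed.

Lemma card_region_internal u : (u < m)%N -> (n * m <= 4 * #|region u|)%N.
Proof.
move=> um; pose i0 : 'I_n := Ordinal (ltn_trans (ltn0Sn 14) n_gt15).
have -> : region u = setX [set~ i0] [set j : 'I_m | (j < uphalf m)%N].
  by rewrite /region um; apply/setP => -[i j]; rewrite !inE -val_eqE /= lt0n.
rewrite cardsX cardsC1 card_ord card_left.
by have := odd_double_half m; rewrite uphalf_half; nia.
Qed.

Lemma card_region_leaf j : (uphalf m <= j)%N -> #|region (leaf j)| = n.
Proof.
move=> jD; have -> : region (leaf j) = setX [set: 'I_n] [set j].
  rewrite /region ltnNge leaf_ge /=; apply/setP => -[i j']; rewrite !inE /=.
  rewrite (inj_eq leaf_inj); case: eqVneq => //= ->.
  by rewrite ltnNge jD.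
by rewrite cardsX cards1 cardsT card_ord muln1.
Qed.

(** An internal node [u] goes to column [u./2], in row 1 or 2 according to its parity; all leaves go
    to row 0. *)
Lemma placed_exists : exists z, z \in placed.
Proof.
pose i0 : 'I_n := Ordinal (ltn_trans (ltn0Sn 14) n_gt15).
pose j0 : 'I_m := Ordinal (ltn_trans (ltn0Sn 2) m_gt3).
pose z : {ffun node -> cell n m} := [ffun u : node =>
  if (u < m)%N then (insubd i0 (odd u).+1, insubd j0 u./2)
  else (i0, insubd j0 (leaf_column m u))].
have zint u : (u < m)%N -> (z u).1 = (odd u).+1 :> nat /\ (z u).2 = u./2 :> nat.
  move=> um; rewrite ffunE um !val_insubd.
  by case: ifP => ?; case: ifP => ?; split=> //; lia.
have zleaf u : (m <= u)%N -> (z u).1 = 0%N :> nat /\ leaf (z u).2 = u.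
  move=> mu; rewrite ffunE ltnNge mu /=; split=> //.
  have [] := @leaf_columnP m u; first by rewrite mu /=.
  move=> cm cu; apply: val_inj; rewrite /= val_insubd cm.
  exact: cu.
exists z; rewrite inE; apply/andP; split.
  apply/injectiveP => u v zuv.
  case: (ltnP u m) => um; case: (ltnP v m) => vm.
  - have [] := zint _ um; have [] := zint _ vm; rewrite zuv => -> -> [o] h.
    by apply: val_inj; rewrite /= -(odd_double_half u) -(odd_double_half v) o h.
  - by have [e _] := zint _ um; have [] := zleaf _ vm; rewrite -zuv e.
  - by have [e _] := zleaf _ um; have [] := zint _ vm; rewrite -zuv e.
  - by have [_ <-] := zleaf _ um; have [_ <-] := zleaf _ vm; rewrite zuv.
apply/forallP => u; rewrite /region; case: ltnP => um; rewrite inE.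
  have [-> ->] := zint _ um; rewrite /=.
  by have := odd_double_half m; rewrite uphalf_half; lia.
by have [-> ->] := zleaf _ um; rewrite eqxx implybT.
Qed.

Lemma sum_column_queries (s : seq (cell n m)) :
  (\sum_(j : 'I_m | (uphalf m <= j)%N) #|[set c in region (leaf j) | c \in s]|
   <= size s)%N.
Proof.
apply: (@leq_trans #|[set c in s]|); last by rewrite cardsE card_size.
rewrite -sum1_card (partition_big (fun c => c.2) xpredT) //=.
rewrite [X in (_ <= X)%N](bigID (fun j : 'I_m => (uphalf m <= j)%N)) /=.
apply: leq_trans (leq_addr _ _); apply: leq_sum => j jD.
rewrite sum1dep_card; apply: subset_leq_card; apply/subsetP => c.
rewrite /region ltnNge leaf_ge /= !inE => /andP[/andP[/eqP/leaf_inj -> _] ->].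
by rewrite eqxx.
Qed.

Lemma parent_iter_ltn k u : (iter k.+1 parent u < m)%N.
Proof.
elim: k => [|k IH] /=; first by rewrite ltn_half_double -mul2n.
by apply: leq_ltn_trans IH; rewrite leq_half_double -addnn leqW ?leq_addr.
Qed.

Lemma parent_iter_stable k u : (u < 2 ^ k)%N ->
  iter k parent u = parent (iter k parent u).
Proof.
move=> uk; suff e : iter k parent u = 0%N :> nat by apply: val_inj; rewrite /= e.
elim: k u uk => [|k IH] u; first by case: u => -[].
by rewrite expnS iterSr => uk; apply: IH; rewrite /=; lia.
Qed.

(** * Counting the leaves found by a deterministic tree *)

Local Notation depth := (trunc_log 2 m).+2.
Local Notation dt := (dtree (cell n m) (Sigma n m)).

Lemma internal_fresh_bound (t : dt) u : (u < m)%N ->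
  (n * m * #|[set z in placed | fresh board parent t z u]| <=
   16 * \sum_(z in placed) dt_queries t (board z))%N.
Proof.
move=> um; have rm := card_region_internal um.
(* At most [2 * m] cells are occupied, while the region has at least [n * m / 4 >= 4 * m] cells, as
   [15 < n]. *)
have occ z : z \in placed ->
    (2 * #|region u :&: [set z v | v in node]| <= #|region u|)%N.
  move=> _; have : (#|region u :&: [set z v | v in node]| <= 2 * m)%N.
    apply: leq_trans (subset_leq_card (subsetIr _ _)) _.
    by apply: leq_trans (leq_imset_card _ _) _; rewrite card_ord.
  by nia.
have := fresh_bound board_move t occ.
have : (\sum_(z in placed) #|[set c in region u | c \in dt_trace t (board z)]|
        <= \sum_(z in placed) dt_queries t (board z))%N.
  apply: leq_sum => z _; rewrite -size_dt_trace; apply: leq_trans (card_size _).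
  by apply: subset_leq_card; apply/subsetP => c; rewrite inE => /andP[].
move=> le_S le_sum; apply: leq_trans (leq_mul rm (leqnn _)) _.
rewrite -mulnA (mulnC #|region u|) (_ : 16 = 4 * 4)%N // -mulnA leq_mul2l /=.
by apply: leq_trans le_sum _; rewrite leq_mul2l.
Qed.

(** A right column contains no node but its leaf. Only queries in that column are counted, so that
    summing over the columns yields the total once. *)
Lemma leaf_fresh_bound (t : dt) j : (uphalf m <= j)%N ->
  (n * #|[set z in placed | fresh board parent t z (leaf j)]| <=
   4 * \sum_(z in placed)
     #|[set c in region (leaf j) | c \in dt_trace t (board z)]|)%N.
Proof.
move=> jD; rewrite mulnC -[X in (_ * X)%N](card_region_leaf jD).
apply: fresh_bound => [|z zP]; first exact: board_move.
rewrite card_region_leaf //.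
suff -> : region (leaf j) :&: [set z v | v in node] = [set z (leaf j)].
  by rewrite cards1; lia.
apply/setP => c; rewrite in_setI in_set1; apply/andP/eqP => [[cr /imsetP[v _ cv]]|->].
  rewrite cv; congr (z _); apply: placed_right_column zP jD _; rewrite -cv.
  by move: cr; rewrite /region ltnNge leaf_ge /= inE => /andP[/eqP/leaf_inj].
by rewrite placement_mem // imset_f.
Qed.

Lemma found_leaf_fresh (t : dt) z j :
  ((z (leaf j) \in dt_trace t (board z)) <=
   fresh board parent t z (leaf j) +
   \sum_(k < depth) fresh board parent t z (iter k.+1 parent (leaf j)))%N.
Proof.
(* Since [2 * m < 2 ^ depth], halving [depth] times takes every node to node 0. *)
have stable : iter depth parent (leaf j) = parent (iter depth parent (leaf j)).
  apply: parent_iter_stable; apply: leq_trans (ltn_ord _) _.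
  have /andP[_] := @trunc_log_bounds 2 m isT (leq_trans (ltn0Sn 3) m_gt3).
  by rewrite (expnS 2 (trunc_log 2 m).+1); lia.
case found: (_ \in _) => //.
have [k kf] := exists_fresh stable found.
case: (unliftP ord0 k) kf => [k' ->|-> -> //]; rewrite lift0 => kf.
by rewrite (bigD1 k') //= kf addnCA.
Qed.

Lemma found_leaves_bound (t : dt) :
  (n * \sum_(j : 'I_m | (uphalf m <= j)%N)
         #|[set z in placed | z (leaf j) \in dt_trace t (board z)]| <=
   (4 + 16 * depth) * \sum_(z in placed) dt_queries t (board z))%N.
Proof.
set S := (\sum_(z in placed) _)%N.
pose F u := #|[set z in placed | fresh board parent t z u]|.
have cardE (P : pred {ffun node -> cell n m}) :
    #|[set z in placed | P z]| = (\sum_(z in placed) P z)%N.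
  rewrite -sum1dep_card big_mkcondr; apply: eq_bigr => z _; by case: (P z).
have leafS : (n * \sum_(j : 'I_m | (uphalf m <= j)%N) F (leaf j) <= 4 * S)%N.
  rewrite big_distrr /=; apply: (@leq_trans (\sum_(j : 'I_m | (uphalf m <= j)%N)
    4 * \sum_(z in placed)
      #|[set c in region (leaf j) | c \in dt_trace t (board z)]|)%N).
    by apply: leq_sum => j; apply: leaf_fresh_bound.
  rewrite -big_distrr leq_mul2l /= exchange_big /=; apply: leq_sum => z _.
  by rewrite -size_dt_trace sum_column_queries.
(* Each of at most [m] leaves contributes [16 * S / (n * m)], so the small regions of the leaves are
   not involved and [m] cancels. *)
have intS k : (n * \sum_(j : 'I_m | (uphalf m <= j)%N) F (iter k.+1 parent (leaf j))
               <= 16 * S)%N.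
  rewrite -(@leq_pmul2r m) 1?(leq_trans _ m_gt3) // mulnAC big_distrr /=.
  apply: (@leq_trans (\sum_(j : 'I_m | (uphalf m <= j)%N) 16 * S)%N).
    by apply: leq_sum => j _; apply/internal_fresh_bound/parent_iter_ltn.
  rewrite sum_nat_const mulnC leq_mul2l; apply/orP; right.
  by rewrite -[X in (_ <= X)%N]card_ord max_card.
apply: (@leq_trans (n * \sum_(j : 'I_m | (uphalf m <= j)%N)
    (F (leaf j) + \sum_(k < depth) F (iter k.+1 parent (leaf j))))%N).
  rewrite leq_mul2l; apply/orP; right; apply: leq_sum => j _.
  rewrite /F !cardE.
  under [X in (_ <= _ + X)%N]eq_bigr do rewrite cardE.
  rewrite exchange_big -big_split /=; apply: leq_sum => z _.
  exact: found_leaf_fresh.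
rewrite big_split exchange_big /= mulnDr mulnDl; apply: leq_add => //.
rewrite big_distrr /=; apply: (@leq_trans (\sum_(k < depth) 16 * S)%N).
  by apply: leq_sum => k _; exact: intS.
by rewrite sum_nat_const card_ord mulnCA mulnA.
Qed.

(** * Averaging over the randomized tree and the placements *)

Lemma mass_le (S : Type) (T : seq (RR * S)) (P P1 P2 : pred S) :
    all (fun p => 0 <= p.1) T -> \sum_(p <- T) p.1 = 1 ->
    (forall s, P1 s && P2 s ==> P s) ->
  \sum_(p <- T | P1 p.2) p.1 + \sum_(p <- T | P2 p.2) p.1 <=
  1 + \sum_(p <- T | P p.2) p.1.
Proof.
move=> + <- P12.
elim: T => [|p T IH]; first by rewrite !big_nil addr0.
rewrite /= !big_cons => /andP[p0 /IH{}IH].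
have := P12 p.2; case: (P1 p.2); case: (P2 p.2); case: (P p.2) => //= _; lra.
Qed.

Lemma weighted_sum_le (S : Type) (T : seq (RR * S)) (F1 F2 : S -> RR) :
    all (fun p => 0 <= p.1) T -> (forall s, F1 s <= F2 s) ->
  \sum_(p <- T) p.1 * F1 p.2 <= \sum_(p <- T) p.1 * F2 p.2.
Proof.
move=> + F12; elim: T => [|p T IH] /=; first by rewrite !big_nil.
by rewrite !big_cons => /andP[p0 /IH{}IH]; rewrite lerD // ler_wpM2l.
Qed.

(** A tree that misses the one cell where the two boards differ answers both alike and errs on one
    of them. By the union bound the remaining mass is at least [9 / 10 + 9 / 10 - 1]. *)
Lemma found_leaf_mass T z j : rdt_valid T ->
    (forall x, 9 / 10 <= rdt_success T (@h1 n m) x) ->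
    z \in placed -> (uphalf m <= j)%N ->
  8 / 10 <= \sum_(p <- T | z (leaf j) \in dt_trace p.2 (board z)) p.1.
Proof.
move=> [T0 T1] ok zP jD.
have := ok (board z); have := ok (rooted_board z j).
rewrite /rdt_success (h1_board zP) (h1_rooted_board zP jD).
have := @mass_le _ T (fun t : dt => z (leaf j) \in dt_trace t (board z))
  (fun t => dt_eval t (board z) == false)
  (fun t => dt_eval t (rooted_board z j) == true) T0 T1.
have H : forall t : dt, (dt_eval t (board z) == false) &&
    (dt_eval t (rooted_board z j) == true) ==>
    (z (leaf j) \in dt_trace t (board z)).
  move=> t; apply/implyP => /andP[/eqP e0 /eqP e1]; apply: contraT => zN.
  suff e : dt_eval t (board z) = dt_eval t (rooted_board z j) by rewrite e e1 in e0.
  apply: eq_dt_eval => c ct; rewrite rooted_board_neq //.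
  by apply: contraNneq zN => <-.
move=> /(_ H); lra.
Qed.

Lemma worst_cost_ge T : rdt_valid T ->
    (forall x, 9 / 10 <= rdt_success T (@h1 n m) x) ->
  (8 / 10) * (n * m./2)%:R <= (4 + 16 * depth)%:R * rdt_worst_cost T.
Proof.
move=> Tv ok; have [T0 T1] := Tv.
have [z0 z0P] := placed_exists.
have P0 : (0 : RR) < #|placed|%:R by rewrite ltr0n; apply/card_gt0P; exists z0.
(* Sums over all placements replace expectations, at the price of the common factor [#|placed|]. *)
rewrite -(ler_pM2r P0).
have right_card : #|[pred j : 'I_m | (uphalf m <= j)%N]| = m./2.
  have := cardC [pred j : 'I_m | (uphalf m <= j)%N].
  have -> : #|[predC [pred j : 'I_m | (uphalf m <= j)%N]]| = uphalf m.
    by rewrite -[RHS]card_left cardsE; apply: eq_card => j; rewrite !inE -ltnNge.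
  rewrite card_ord => e; apply: (@addIn (uphalf m)); rewrite e.
  by rewrite -[LHS]odd_double_half uphalf_half -addnn addnCA.
pose found (t : dt) := (\sum_(j : 'I_m | (uphalf m <= j)%N)
  #|[set z in placed | z (leaf j) \in dt_trace t (board z)]|)%N.
have foundE t : (found t)%:R = \sum_(z in placed) \sum_(j : 'I_m | (uphalf m <= j)%N)
    (z (leaf j) \in dt_trace t (board z))%:R :> RR.
  rewrite exchange_big natr_sum; apply: eq_bigr => j _.
  by rewrite -natr_sum -sum1dep_card big_mkcondr; congr (_%:R).
have lower : (8 / 10) * (m./2)%:R * #|placed|%:R <= \sum_(p <- T) p.1 * (found p.2)%:R.
  under eq_bigr => p _.
    rewrite foundE big_distrr /=; under eq_bigr do rewrite big_distrr /=; over.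
  rewrite exchange_big /=; under eq_bigr do rewrite exchange_big /=.
  apply: (@le_trans _ _ (\sum_(z in placed) \sum_(j : 'I_m | (uphalf m <= j)%N) (8 / 10))).
    by rewrite !sumr_const right_card !mulr_natr.
  apply: ler_sum => z zP; apply: ler_sum => j jD.
  apply: le_trans (found_leaf_mass Tv ok zP jD) _.
  rewrite [X in X <= _]big_mkcond; apply: ler_sum => p _.
  by case: (_ \in _); rewrite ?mulr1 ?mulr0.
have upper : n%:R * \sum_(p <- T) p.1 * (found p.2)%:R <=
    (4 + 16 * depth)%:R * \sum_(z in placed) rdt_cost T (board z).
  have -> : \sum_(z in placed) rdt_cost T (board z) =
      \sum_(p <- T) p.1 * (\sum_(z in placed) dt_queries p.2 (board z))%:R.
    rewrite /rdt_cost exchange_big; apply: eq_bigr => p _.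
    by rewrite -big_distrr natr_sum.
  rewrite !big_distrr /=; under eq_bigr do rewrite mulrCA -natrM.
  under [X in _ <= X]eq_bigr do rewrite mulrCA -natrM.
  apply: (weighted_sum_le (F1 := fun t => (n * found t)%:R)
    (F2 := fun t => ((4 + 16 * depth) * \sum_(z in placed) dt_queries t (board z))%:R)) => //.
  by move=> t; rewrite ler_nat found_leaves_bound.
have worst : \sum_(z in placed) rdt_cost T (board z) <= rdt_worst_cost T * #|placed|%:R.
  rewrite mulr_natr -sumr_const; apply: ler_sum => z _.
  exact: le_bigmax.
rewrite natrM -[X in _ <= X]mulrA.
apply: (@le_trans _ _ (n%:R * \sum_(p <- T) p.1 * (found p.2)%:R)).
  by rewrite [8 / 10 * _]mulrCA -[X in X <= _]mulrA ler_wpM2l.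
by apply: le_trans upper _; rewrite ler_wpM2l.
Qed.

End Board.

(** * Passage to the natural logarithm and conclusion *)

Lemma ln2_ge_half : 1 / 2 <= ln (2 : RR).
Proof.
have := @le_ln1Dx RR (- (1 / 2)); rewrite (_ : 1 + - (1 / 2) = 2^-1); last by lra.
by rewrite lnV ?posrE // => /(_ _); lra.
Qed.

Lemma trunc_log_le_ln m : (0 < m)%N -> (trunc_log 2 m)%:R <= 2 * ln (m%:R : RR).
Proof.
move=> m0; have /andP[rm _] := @trunc_log_bounds 2 m isT m0.
have : ln ((2 ^ trunc_log 2 m)%:R : RR) <= ln m%:R.
  by rewrite ler_ln ?posrE ?ltr0n ?expn_gt0 // ler_nat.
rewrite natrX lnXn // -[ln 2%:R *+ _]mulr_natr => h.
have h2 := ln2_ge_half; have k0 : (0 : RR) <= (trunc_log 2 m)%:R by [].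
by have := ler_wpM2r k0 h2; lra.
Qed.

Theorem theorem17 :
  exists c : RR, 0 < c /\
  exists N : nat, forall n m : nat, (N <= n)%N -> (N <= m)%N ->
    c * (n * m)%:R / ln (m%:R : RR) <= Rquery (@h1 n m).
Proof.
(* The estimates below give [n * m <= 3 * (10 / 8) * 68 * L * W = 255 * L * W], where [L] is [ln m]
   and [W] the cost; 300 is a rounding. *)
exists (1 / 300); split; first by lra.
exists 16%N => n m n16 m16.
have m0 : (0 < m)%N by lia.
have m1 : (3 < m)%N by lia.
apply: lb_le_inf.
  (* The infimum of the empty set defaults to 0, so some correct tree must be exhibited: the one
     that reads every cell. *)
  pose x0 : {ffun cell n m -> Sigma n m} := [ffun=> (true, None, None, None)].
  pose T : rdtree (cell n m) (Sigma n m) := [:: (1, full_tree (@h1 n m) (enum predT) x0)].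
  exists (rdt_worst_cost T), T; split=> //.
    by split; rewrite ?big_seq1 //= ler01.
  move=> x; rewrite /rdt_success big_mkcond big_seq1 /= full_treeP ?eqxx; first lra.
  by move=> q; rewrite mem_enum.
move=> _ [T [Tv ok ->]].
have := worst_cost_ge n16 m1 Tv ok.
set W := rdt_worst_cost T; set L := ln _ => h.
(* From [2 <= r <= 2 * L] follows [1 <= L], which absorbs the constant in
   [36 + 16 * r <= 36 + 32 * L <= 68 * L]. *)
have r2 : (2 <= trunc_log 2 m)%N.
  by rewrite -(@trunc_expnK 2 2) //; apply: leq_trunc_log; lia.
have rL := trunc_log_le_ln m0; rewrite -/L in rL.
have {}r2 : (2 : RR) <= (trunc_log 2 m)%:R by rewrite (ler_nat _ 2).
have L0 : 0 < L by lra.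
rewrite ler_pdivrMr //.
have W0 : 0 <= W by apply: bigmax_ge_id.
have le_nm : ((n * m)%:R : RR) <= 3 * (n * m./2)%:R.
  by rewrite -natrM ler_nat mulnCA leq_mul2l; have := odd_double_half m; lia.
have depth_le : ((4 + 16 * (trunc_log 2 m).+2)%:R : RR) <= 68 * L.
  by rewrite -[(trunc_log 2 m).+2]addn2 natrD natrM natrD; lra.
have := le_trans h (ler_wpM2r W0 depth_le); rewrite (mulrC W); nra.
Qed.
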